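(* Let $F$ be a higher local field, that is, an $n$-dimensional local field with $n\ge 1$. Let $\tau$ be a higher topology on $F$ and let $\tau_s$ be its sequential saturation. Then the collections of open subgroups (of the additive group of $F$) for $\tau$ and for $\tau_s$ agree: a subgroup $H\subset F$ is open for $\tau$ if and only if it is open for $\tau_s$.
   Context: Sequential saturation: a subset $A$ of a topological space $(X,\tau)$ is sequentially open if for every sequence $(x_n)$ in $X$ converging to a point $x\in A$, all but finitely many $x_n$ lie in $A$. Sequentially open sets form a topology $\tau_s$ finer than $\tau$, called the sequential saturation of $\tau$. A zero-dimensional local field is a finite field; for $n\ge1$, an $n$-dimensional local field is a complete discrete valuation field $F$ whose residue field $\overline{F}$ is an $(n-1)$-dimensional local field. $\mathcal{O}_F$ is the ring of integers of the normalized discrete valuation of $F$, $\pi_F$ a generator of its maximal ideal $\mathfrak{p}_F$, $\overline{F}=\mathcal{O}_F/\mathfrak{p}_F$, and $\rho:\mathcal{O}_F\to\overline F$ is the quotient map. Higher topologies are the topologies constructed inductively on $n$ as follows. A finite field has the discrete topology. Let $n\geq 1$ and suppose $\overline F$ has been given a higher topology. (1) If $\mathrm{char}\,F=\mathrm{char}\,\overline F$, choose an isomorphism $F\simeq\overline F((t))$. A basis of open neighbourhoods of zero of a group topology on $F$ is given by the sets $\mathcal{U}=\{\sum_{i\gg-\infty} f_it^i : f_i\in U_i\}$, where $(U_i)_{i\in\mathbb{Z}}$ is a sequence of open neighbourhoods of zero in $\overline F$ with $U_i=\overline F$ for all $i\geq i_0$, for some $i_0\in \mathbb{Z}$. (2)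 For a complete discrete valuation field $L$ with valuation $v_L$, let $L\{\{t\}\}$ be the field of all $\sum_{i=-\infty}^{\infty}a_it^i$ with $a_i\in L$, $\inf_i v_L(a_i)>-\infty$ and $\lim_{i\to-\infty}a_i=0$ (valuation topology), with discrete valuation $v(\sum a_it^i)=\inf_i v_L(a_i)$ and residue field $\overline L((t))$. Suppose $F=K\{\{t_1\}\}\cdots\{\{t_{n-1}\}\}$ is standard of mixed characteristic, with $K$ a local field of characteristic zero with finite residue field of characteristic $p$, and take $\pi_F=\pi_K$. The canonical lifting $h:\overline F\to\mathcal{O}_F$ is the set-theoretic section of $\rho$ defined inductively: for $n=1$ it is the Teichmüller lift, and for $F=F'\{\{t\}\}$ one sets $h(\sum_i a_it^i)=\sum_i h'(a_i)t^i$, with $h'$ the canonical lifting of $F'$. Every element of $F$ is uniquely of the form $\sum_{i\gg-\infty}h(f_i)\pi_F^i$ with $f_i\in\overline F$. A basis of open neighbourhoods of zero of a group topology on $F$ is given by the sets $\mathcal{U}=\{\sum_{i\gg-\infty}h(f_i)\pi_F^i: f_i\in U_i\}$, with $(U_i)$ as in (1). (3) If $F$ is of mixed characteristic ($\mathrm{char}\,F\ne\mathrm{char}\,\overline F$) but not standard, choose a subfield $M\subset F$ with $F/M$ finite and $M$ standard as in (2), and give $F$ the product topology through an $M$-linear isomorphism $F\simeq M^{[F:M]}$. When $\mathrm{char}\,\overline F=p>0$, the higher topology is independent of the choices made. *)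

(* Defs.v *)
From HB Require Import structures.
From mathcomp Require Import all_boot all_order all_algebra.
From mathcomp Require Import all_classical all_reals all_analysis.
Set Implicit Arguments.
Unset Strict Implicit.
Unset Printing Implicit Defensive.
Import Order.TTheory GRing.Theory Num.Theory.
Local Open Scope classical_set_scope.
Local Open Scope ring_scope.

(* A higher topology is in general not a ring topology (multiplication need
   not be jointly continuous), so no compatibility between the two structures
   is built in. *)
#[short(type="topFieldType")]
HB.structure Definition TopField := {F of GRing.Field F & Topological F}.

Section SequentialSaturation.
Context (T : topologicalType).

Definition seq_open (A : set T) : Prop :=
  forall (u : nat -> T) (x : T), A x -> u @ \oo --> x ->
    \forall n \near \oo, A (u n).

Lemma seq_openT : seq_open setT.
Proof. by move=> u x _ _; exact: filterT. Qed.

Lemma seq_openI : setI_closed seq_open.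
Proof.
move=> A B oA oB u x [Ax Bx] ux.
by apply: filterI; [exact: oA ux | exact: oB ux].
Qed.

Lemma seq_open_bigU (I : Type) (f : I -> set T) :
  (forall i, seq_open (f i)) -> seq_open (\bigcup_i f i).
Proof.
move=> of_ u x [i _ fix_] ux.
by apply: filterS (of_ i u x fix_ ux) => n fun_; exists i.
Qed.

Definition seq_saturation : Type := T.

HB.instance Definition _ := Choice.on seq_saturation.
HB.instance Definition _ := isOpenTopological.Build seq_saturation
  seq_openT seq_openI seq_open_bigU.

End SequentialSaturation.

Section Valuations.
Context (F : fieldType) (v : F -> \bar int).

Definition val_cvg (u : nat -> F) (l : F) : Prop :=
  forall N : int, \forall n \near \oo, (N%:E <= v (u n - l)%R)%E.

Definition val_cauchy (u : nat -> F) : Prop :=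
  forall N : int, \forall m \near \oo & n \near \oo,
    (N%:E <= v (u m - u n)%R)%E.

Definition val_sum (a : int -> F) (s : F) : Prop :=
  val_cvg (fun r => \sum_(j < r.*2.+1) a (j%:Z - r%:Z)) s.

Record complete_discrete_valuation : Prop := {
  valuation0 : v 0 = +oo%E;
  valuation_fin : forall x : F, x != 0 -> v x \is a fin_num;
  valuationM : forall x y, v (x * y) = (v x + v y)%E;
  valuationD : forall x y, (Order.min (v x) (v y) <= v (x + y)%R)%E;
  valuation_normalized : exists x, v x = 1%:E;
  valuation_complete : forall u, val_cauchy u -> exists l, val_cvg u l
}.

(* [rho] exhibits [k] as the quotient of the ring of integers by its maximal
   ideal; its values outside the ring of integers are irrelevant. *)
Record residue_map (k : fieldType) (rho : F -> k) : Prop := {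
  residue1 : rho 1 = 1;
  residueD : forall x y, (0 <= v x)%E -> (0 <= v y)%E ->
    rho (x + y) = rho x + rho y;
  residueM : forall x y, (0 <= v x)%E -> (0 <= v y)%E ->
    rho (x * y) = rho x * rho y;
  residue_ker : forall x, (0 <= v x)%E -> rho x = 0 <-> (0 < v x)%E;
  residue_surj : forall a : k, exists2 x, (0 <= v x)%E & rho x = a
}.

End Valuations.

Inductive local_field : nat -> fieldType -> Prop :=
| LocalField0 (F : fieldType) : finite_set [set: F] -> local_field 0 F
| LocalFieldS (n : nat) (F k : fieldType) (v : F -> \bar int) (rho : F -> k) :
    complete_discrete_valuation v -> residue_map v rho -> local_field n k ->
    local_field n.+1 F.

(* [c] is an isomorphism of [F] with k((t)), sending an element to its
   sequence of coefficients. *)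
Record laurent_iso (F k : fieldType) (c : F -> int -> k) : Prop := {
  laurent_bij : set_bij [set: F]
    [set f : int -> k | exists m : int, forall i : int, i < m -> f i = 0] c;
  laurentD : forall x y i, c (x + y) i = c x i + c y i;
  laurentM : forall x y m,
    c (x * y) m = \sum_(i \in [set: int]) c x i * c y (m - i)
}.

(* [c] is an isomorphism of [F], with its valuation [v], with L{{t}}, sending
   an element to its sequence of coefficients. *)
Record mixed_iso (L : fieldType) (vL : L -> \bar int) (F : fieldType)
    (v : F -> \bar int) (c : F -> int -> L) : Prop := {
  mixed_bij : set_bij [set: F]
    [set a : int -> L |
      (exists N : int, forall i, (N%:E <= vL (a i))%E) /\
      (forall N : int, exists m : int, forall i : int, i < m ->
        (N%:E <= vL (a i))%E)] c;
  mixedD : forall x y i, c (x + y) i = c x i + c y i;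
  mixedM : forall x y m,
    val_sum vL (fun i => c x i * c y (m - i)) (c (x * y) m);
  (* v x = inf_i vL (c x i), as a greatest lower bound *)
  mixed_val : forall x (z : \bar int),
    (z <= v x)%E <-> forall i, (z <= vL (c x i))%E
}.

(* [F], with its valuation, residue map and uniformizer [pi], is
   K{{t_1}}...{{t_m}} (of dimension m + 1) with [pi] a uniformizer of [K],
   and [h] is its canonical lifting. The Teichmueller lift is the unique
   multiplicative section of the residue map of [K]. *)
Fixpoint canonical_lifting (m : nat) (F k : fieldType) (v : F -> \bar int)
    (rho : F -> k) (pi : F) (h : k -> F) {struct m} : Prop :=
  complete_discrete_valuation v /\ residue_map v rho /\
  match m with
  | 0 => [/\ [pchar F] =i pred0, finite_set [set: k], v pi = 1%:E,
             (forall a, (0 <= v (h a))%E /\ rho (h a) = a) &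
             (forall a b, h (a * b) = h a * h b)]
  | m'.+1 =>
      exists (L l : fieldType) (vL : L -> \bar int) (rhoL : L -> l)
        (piL : L) (hL : l -> L) (c : F -> int -> L) (cb : k -> int -> l),
      canonical_lifting m' vL rhoL piL hL /\
      [/\ mixed_iso vL v c,
          laurent_iso cb,
          (forall x i, (0 <= v x)%E -> cb (rho x) i = rhoL (c x i)),
          (forall i, c pi i = if i == 0 then piL else 0) &
          (forall a i, c (h a) i = hL (cb a i))]
  end.

Definition standard_field (m : nat) (F : fieldType) : Prop :=
  exists (k : fieldType) (v : F -> \bar int) (rho : F -> k) (pi : F)
    (h : k -> F), canonical_lifting m v rho pi h.

Definition additive_group_topology (F : topFieldType) : Prop :=
  continuous (fun xy : F * F => xy.1 + xy.2) /\ continuous (fun x : F => - x).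

Definition open_base_at0 (F : topFieldType) (B : set (set F)) : Prop :=
  (forall V, B V -> open_nbhs 0 V) /\
  (forall W : set F, nbhs 0 W -> exists2 V, B V & V `<=` W).

Definition nbhs0_sequence (k : topFieldType) (U : int -> set k) : Prop :=
  (forall i, open_nbhs 0 (U i)) /\
  exists i0 : int, forall i : int, i0 <= i -> U i = setT.

Definition laurent_base (F : fieldType) (k : topFieldType) (c : F -> int -> k) :
  set (set F) :=
  [set V | exists2 U, nbhs0_sequence U & V = [set x | forall i, U i (c x i)]].

Definition lifting_base (F : fieldType) (k : topFieldType) (v : F -> \bar int)
    (pi : F) (h : k -> F) : set (set F) :=
  [set V | exists2 U, nbhs0_sequence U &
    V = [set x | exists f : int -> k,
      [/\ exists m : int, forall i : int, i < m -> f i = 0,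
          forall i, U i (f i) &
          val_sum v (fun i => h (f i) * pi ^ i) x]]].

(* [higher_topology n F]: the topology carried by [F] is a higher topology on
   [F] as an n-dimensional local field. *)
Inductive higher_topology : nat -> topFieldType -> Prop :=
| HigherFinite (F : topFieldType) :
    finite_set [set: F] -> (forall A : set F, open A) -> higher_topology 0 F
| HigherEqualChar (n : nat) (F k : topFieldType) (v : F -> \bar int)
    (rho : F -> k) (c : F -> int -> k) :
    complete_discrete_valuation v -> residue_map v rho ->
    higher_topology n k ->
    [pchar F] =i [pchar k] ->
    laurent_iso c ->
    additive_group_topology F -> open_base_at0 (laurent_base c) ->
    higher_topology n.+1 F
| HigherStandard (n : nat) (F k : topFieldType) (v : F -> \bar int)
    (rho : F -> k) (pi : F) (h : k -> F) :
    canonical_lifting n v rho pi h ->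
    higher_topology n k ->
    additive_group_topology F -> open_base_at0 (lifting_base v pi h) ->
    higher_topology n.+1 F
(* As [M] is standard, its higher topology is the one of [HigherStandard]. *)
| HigherNonStandard (n : nat) (F : topFieldType) (k : fieldType)
    (v : F -> \bar int) (rho : F -> k) (M : topFieldType)
    (iota : {rmorphism M -> F}) (d : nat) (phi : F -> 'rV[M]_d) :
    complete_discrete_valuation v -> residue_map v rho -> local_field n k ->
    ~ ([pchar F] =i [pchar k]) -> ~ standard_field n F ->
    standard_field n M -> higher_topology n.+1 M ->
    bijective phi ->
    (forall x y, phi (x + y) = phi x + phi y) ->
    (forall a x, phi (iota a * x) = a *: phi x) ->
    (forall A : set F, open A <-> open (phi @` A)) ->
    higher_topology n.+1 F.

(* Main.v *)
Require Import Defs.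
From mathcomp Require Import all_boot all_order all_algebra.
From mathcomp Require Import all_classical all_reals all_analysis.
From mathcomp Require Import zify ring.
Set Implicit Arguments.
Unset Strict Implicit.
Unset Printing Implicit Defensive.
Import Order.TTheory GRing.Theory Num.Theory.
Local Open Scope classical_set_scope.
Local Open Scope ring_scope.

(** The sequential saturation refines the topology, so the point is that a
    sequentially open subgroup H is open. Only two consequences of sequential
    openness are needed: H contains 0, and every sequence tending to 0 ends up
    in H. From this it follows, by induction along the construction of the
    higher topology, that H is a neighbourhood of 0 ([higher_topology_nbhs0]);
    since translations are continuous ([higher_topology_translation]), H is then
    open.

    Write the elements of F as expansions: sums of terms e i (f i), where e i a
    is a t^i in equal characteristic and h(a) pi^i in the standard mixed case.

    - H contains every expansion starting at some fixed index N
      ([absorbed_tail]). Otherwise there would be, for each n, an expansion x_n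
      starting at index n or later and lying outside H; but x_n tends to 0,
      because a basic neighbourhood restricts only the coefficients of index
      below some i0.

    - Modulo such tails an expansion is a finite sum of terms. Hence H is a
      neighbourhood of 0 as soon as each set A_i of the a such that e i a is in
      H is a neighbourhood of 0 in the residue field ([nbhs_of_term_nbhs]).

    - In equal characteristic e i is additive and continuous at 0, so A_i is a
      subgroup that absorbs null sequences, and the induction hypothesis applies
      to it ([laurent_nbhs0]).

    - In the standard mixed case h is not additive and A_i need not be a
      subgroup. One argues by descending induction on i ([lifted_nbhs0]). The
      carry e i a + e i b - e i (a + b) has an expansion starting after i.
      Continuity of the addition of F at (0, 0) forces the coefficients of this
      expansion to lie in the neighbourhoods A_j for j > i, as soon as a and b
      are close to 0; so the carry is in H. The residue field has positive
      characteristic, so its higher topology has a base at 0 made of subgroups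
      ([higher_topology_subgroup_base]), and a and b may be taken in a subgroup
      W that is a neighbourhood of 0. Then A_i meets W in a subgroup, to which
      the induction hypothesis applies.

    - A finite extension of a standard field M is M^d, and a subgroup of M^d
      contains the product of its traces on the coordinate axes
      ([coordinates_nbhs0]). *)

(** * Subgroups and null sequences *)

Definition add_subgroup (F : zmodType) (H : set F) : Prop :=
  H 0 /\ forall x y, H x -> H y -> H (x - y).

Section AddSubgroup.
Context (F : zmodType) (H : set F) (sH : add_subgroup H).

Lemma add_subgroup0 : H 0. Proof. by case: sH. Qed.

Lemma add_subgroupB x y : H x -> H y -> H (x - y).
Proof. by case: sH => _; apply. Qed.

Lemma add_subgroupN x : H x -> H (- x).
Proof. by move=> Hx; rewrite -sub0r; apply: add_subgroupB add_subgroup0 _. Qed.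

Lemma add_subgroupD x y : H x -> H y -> H (x + y).
Proof.
by move=> Hx Hy; rewrite -[y]opprK; apply: add_subgroupB Hx (add_subgroupN Hy).
Qed.

End AddSubgroup.

(** For a set containing 0 this is weaker than sequential openness. It pulls back
    along maps sending null sequences to null sequences, so continuity at 0
    suffices, which is all that is known of the terms of a lifted expansion. *)
Definition absorbs_null_sequences (F : topFieldType) (H : set F) : Prop :=
  forall u : nat -> F, u @ \oo --> (0 : F) -> \forall n \near \oo, H (u n).

(** * Discrete valuations, sums of families and residue maps *)

Section Update.
Context (k : Type).
Implicit Types (f : int -> k) (i j : int) (a : k).

Definition update f i a : int -> k := fun j => if j == i then a else f j.

Lemma update_same f i a : update f i a i = a.
Proof. by rewrite /update eqxx. Qed.

Lemma update_other f i a j : j != i -> update f i a j = f j.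
Proof. by rewrite /update => /negbTE ->. Qed.

End Update.

Section Valuation.
Context (F : fieldType) (v : F -> \bar int).
Hypothesis cv : complete_discrete_valuation v.

Lemma valuation1 : v 1 = 0%:E.
Proof.
have := valuationM cv 1 1; rewrite mulr1.
have /fin_numP := valuation_fin cv (oner_neq0 F).
by case: (v 1) => [z||] [] // _ _; rewrite -EFinD => -[] z0; congr EFin; lia.
Qed.

Lemma valuationN x : v (- x) = v x.
Proof.
suff vN1 : v (- 1) = 0%:E by rewrite -mulN1r (valuationM cv) vN1 add0e.
have := valuationM cv (- 1) (- 1); rewrite mulrNN mulr1 valuation1.
have : - 1 != 0 :> F by rewrite oppr_eq0 oner_neq0.
move=> /(valuation_fin cv)/fin_numP.
by case: (v (- 1)) => [z||] [] // _ _; rewrite -EFinD => -[] z0; congr EFin; lia.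
Qed.

Lemma valuation_geD (z : \bar int) x y :
  (z <= v x)%E -> (z <= v y)%E -> (z <= v (x + y)%R)%E.
Proof.
by move=> zx zy; apply: le_trans (valuationD cv x y); rewrite le_min zx.
Qed.

Lemma valuation_geB (z : \bar int) x y :
  (z <= v x)%E -> (z <= v y)%E -> (z <= v (x - y)%R)%E.
Proof. by move=> zx zy; apply: valuation_geD => //; rewrite valuationN. Qed.

Lemma valuation_exprz (pi : F) (i : int) : v pi = 1%:E -> v (pi ^ i) = i%:E.
Proof.
move=> vpi.
have pi0 : pi != 0 by apply/eqP => pi0; move: vpi; rewrite pi0 (valuation0 cv).
have vpos n : v (pi ^+ n) = n%:Z%:E.
  elim: n => [|n IHn]; first by rewrite expr0 valuation1.
  by rewrite exprS (valuationM cv) vpi IHn -EFinD; congr EFin; lia.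
case: i => n; first exact: vpos.
have := valuationM cv (pi ^+ n.+1) (pi ^- n.+1).
rewrite divff ?expf_neq0// valuation1 vpos NegzE -exprnN.
have /(valuation_fin cv)/fin_numP : pi ^- n.+1 != 0.
  by rewrite invr_neq0// expf_neq0.
by case: (v _) => [z||] [] // _ _; rewrite -EFinD => -[] z0; congr EFin; lia.
Qed.

Lemma val_sum_ge (z : int) a s :
  (forall i, (z%:E <= v (a i))%E) -> val_sum v a s -> (z%:E <= v s)%E.
Proof.
move=> az /(_ z) /filter_ex[r zr].
rewrite -[s](subKr (\sum_(j < r.*2.+1) a (j%:Z - r%:Z))).
apply: valuation_geB zr.
apply: (big_ind (fun x => (z%:E <= v x)%E)) => // [|x y].
  by rewrite (valuation0 cv) leey.
exact: valuation_geD.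
Qed.

Lemma val_sum0 : val_sum v (fun=> 0) 0.
Proof.
move=> N; apply: nearW => r.
by rewrite big1// subr0 (valuation0 cv) leey.
Qed.

(** For large r the window [-r, r] contains i, so all but finitely many partial
    sums change by the same amount. *)
Lemma val_sum_update a s i b :
  val_sum v a s -> val_sum v (update a i b) (s - a i + b).
Proof.
move=> sa N; near=> r.
have ir : (absz i <= r)%N by near: r; exact: nbhs_infty_ge.
have ltr : (absz (i + r%:Z)%R < r.*2.+1)%N by lia.
pose j0 := Ordinal ltr.
have j0E : j0%:Z - r%:Z = i by rewrite /=; lia.
have -> : \sum_(j < r.*2.+1) update a i b (j%:Z - r%:Z) - (s - a i + b) =
    \sum_(j < r.*2.+1) a (j%:Z - r%:Z) - s.
  rewrite (bigD1 j0)//= [in RHS](bigD1 j0)//= j0E {1}/update eqxx.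
  rewrite (eq_bigr (fun j : 'I_ _ => a (j%:Z - r%:Z))); last first.
    move=> j jj0; rewrite /update ifN//; apply: contra jj0 => /eqP ji.
    by apply/eqP/val_inj => /=; lia.
  ring.
by near: r; apply: sa.
Unshelve. all: by end_near. Qed.

End Valuation.

Section ResidueMap.
Context (F k : fieldType) (v : F -> \bar int) (rho : F -> k).
Hypotheses (cv : complete_discrete_valuation v) (rv : residue_map v rho).

Lemma residue0 : rho 0 = 0.
Proof.
have v0 : (0 <= v 0)%E by rewrite (valuation0 cv) leey.
by apply: (addrI (rho 0)); rewrite -(residueD rv)// !addr0.
Qed.

Lemma residueN x : (0 <= v x)%E -> rho (- x) = - rho x.
Proof.
move=> vx; apply/eqP; rewrite -addr_eq0 addrC -(residueD rv)//.
  by rewrite subrr residue0.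
by rewrite valuationN.
Qed.

Lemma residueB x y : (0 <= v x)%E -> (0 <= v y)%E ->
  rho (x - y) = rho x - rho y.
Proof. by move=> vx vy; rewrite (residueD rv) ?valuationN// residueN. Qed.

Lemma residue_pchar p : p \in [pchar F] -> p \in [pchar k].
Proof.
move=> /andP[p_pr /eqP p0]; apply/andP; split=> //; apply/eqP.
have v1 : (0 <= v 1)%E by rewrite (valuation1 cv).
have rhon n : (0 <= v n%:R)%E /\ rho n%:R = n%:R.
  elim: n => [|n [vn rn]]; first by rewrite (valuation0 cv) leey residue0.
  by rewrite -!natr1 (residueD rv)// rn (residue1 rv) (valuation_geD cv).
by rewrite -(proj2 (rhon p)) p0 residue0.
Qed.

End ResidueMap.

(** * Expansions *)

(** [E f x] reads: x is the sum of the terms [e i (f i)]. Nothing is said about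
    the convergence or the uniqueness of expansions; changing one coefficient is
    the only operation that the topological arguments need, and it makes sense
    for additive and for non-additive terms. *)
Record expansion_system (k F : zmodType) (E : (int -> k) -> F -> Prop)
    (e : int -> k -> F) : Prop := {
  expansion0 : E (fun=> 0) 0;
  expansion_term0 : forall i, e i 0 = 0;
  expansion_update : forall f x i a,
    E f x -> E (update f i a) (x - e i (f i) + e i a)
}.

Definition expansion_base (k F : topFieldType) (E : (int -> k) -> F -> Prop) :
    set (set F) :=
  [set V | exists2 U, nbhs0_sequence U &
    V = [set x | exists f : int -> k,
      [/\ exists m : int, forall i : int, i < m -> f i = 0,
          forall i, U i (f i) & E f x]]].

Section Expansions.
Context (k F : topFieldType) (E : (int -> k) -> F -> Prop).
Context (e : int -> k -> F).
Hypotheses (Ee : expansion_system E e).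
Hypothesis baseE : open_base_at0 (expansion_base E).

Lemma nbhs0_sequence0 (U : int -> set k) i : nbhs0_sequence U -> U i 0.
Proof. by case=> /(_ i)[]. Qed.

Lemma expansion_cut f x i :
  E f x -> E (update f i 0) (x - e i (f i)).
Proof.
by move=> /(expansion_update Ee i 0); rewrite (expansion_term0 Ee) addr0.
Qed.

Lemma expansion_term i a : E (update (fun=> 0) i a) (e i a).
Proof.
have := expansion_update Ee i a (expansion0 Ee).
by rewrite (expansion_term0 Ee) subrr add0r.
Qed.

Lemma nbhs_expansion_base U : nbhs0_sequence U ->
  nbhs (0 : F) [set x | exists f : int -> k,
      [/\ exists m : int, forall i : int, i < m -> f i = 0,
          forall i, U i (f i) & E f x]].
Proof. by move=> sU; apply/open_nbhs_nbhs/(proj1 baseE); exists U. Qed.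

Lemma nbhs0_expansion (W : set F) : nbhs 0 W -> exists2 U, nbhs0_sequence U &
  forall f x, (exists m : int, forall i : int, i < m -> f i = 0) ->
    (forall i, U i (f i)) -> E f x -> W x.
Proof.
move=> /(proj2 baseE)[_ [U sU ->] UW]; exists U => // f x fm fU fx.
by apply: UW; exists f.
Qed.

Lemma cvg_expansion_term i : e i @ (0 : k) --> (0 : F).
Proof.
move=> W /nbhs0_expansion[U sU UW]; rewrite /= nbhs_simpl.
have : nbhs 0 (U i) by apply: open_nbhs_nbhs; case: sU.
apply: filterS => a Ua; apply: UW (expansion_term i a).
  by exists i => j ji; rewrite update_other// lt_eqF.
by move=> j; rewrite /update; case: eqP => [->|_] //; apply: nbhs0_sequence0.
Qed.

Context (H : set F) (sH : add_subgroup H).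

(** Expansions whose first index tends to infinity form a null sequence, since a
    basic neighbourhood restricts no coefficient of large index. *)
Lemma absorbed_tail : absorbs_null_sequences H ->
  exists N : int, forall f x, (forall i, i < N -> f i = 0) -> E f x -> H x.
Proof.
move=> seqH; apply: contrapT => noN.
have /choice[u uP] (n : nat) : exists x,
    (exists2 f, (forall i, i < n%:Z -> f i = 0) & E f x) /\ ~ H x.
  apply: contrapT => nox; apply: noN; exists n%:Z => f x fn fx.
  by apply: contrapT => Hx; apply: nox; exists x; split=> //; exists f.
have /seqH : u @ \oo --> (0 : F).
  move=> W /nbhs0_expansion[U sU UW]; have [i0 Ui0] := sU.2.
  suff : \forall n \near \oo, W (u n) by [].
  near=> n; have [[f fn fx] _] := uP n.
  apply: UW fx; first by exists n%:Z.
  move=> i; have [/Ui0 -> //|ii0] := leP i0 i.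
  rewrite fn; first exact: nbhs0_sequence0.
  apply: lt_le_trans ii0 _.
  have : (absz i0 <= n)%N by near: n; exact: nbhs_infty_ge.
  lia.
by case/filter_ex => n; have [_] := uP n.
Unshelve. all: by end_near. Qed.

(** The finitely many terms between m and N are removed one by one; the rest is
    an expansion starting at N. *)
Lemma expansion_mem (N m : int) f x :
  (forall f x, (forall i, i < N -> f i = 0) -> E f x -> H x) ->
  (forall i, i < m -> f i = 0) ->
  (forall i, m <= i < N -> H (e i (f i))) -> E f x -> H x.
Proof.
move=> tailH.
have [d] : exists d : nat, N - m <= d%:Z by exists (absz (N - m)); lia.
elim: d => [|d IHd] in m f x *.
  move=> Nm fm _; apply: tailH => i iN; apply: fm; lia.
move=> Nm fm Hf fx.
have [mN|Nm'] := ltP m N; last by apply: tailH fx => i iN; apply: fm; lia.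
rewrite -(subrK (e m (f m)) x).
apply: (add_subgroupD sH); last by apply: Hf; lia.
apply: (IHd (m + 1) _ _ _ _ _ (expansion_cut m fx)); first by lia.
- move=> i im; rewrite /update; case: eqP => // /eqP im'; apply: fm; lia.
- by move=> i im; rewrite update_other; [apply: Hf|]; lia.
Qed.

(** The A_i for i < N, completed by the whole field from N on, define a basic
    neighbourhood of 0 contained in H. *)
Lemma nbhs_of_term_nbhs (N : int) :
  (forall f x, (forall i, i < N -> f i = 0) -> E f x -> H x) ->
  (forall i, i < N -> nbhs 0 [set a | H (e i a)]) -> nbhs 0 H.
Proof.
move=> tailH nH.
pose U i := if i < N then [set a | H (e i a)]° else setT.
have sU : nbhs0_sequence U.
  split; last by exists N => i Ni; rewrite /U ltNge Ni.
  move=> i; rewrite /U; case: ltP => [iN|_]; last by split; [exact: openT|].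
  by split; [exact: open_interior|exact: nH].
apply: filterS (nbhs_expansion_base sU) => x [f [[m fm] fU fx]].
apply: expansion_mem tailH fm _ fx => i /andP[_ iN].
by have := fU i; rewrite /U iN => /interior_subset.
Qed.

End Expansions.

(** * Coefficients and characteristics *)

Section Coefficients.
Context (F L : zmodType) (c : F -> int -> L).
Hypothesis cD : forall x y i, c (x + y) i = c x i + c y i.

Lemma coef0 i : c 0 i = 0.
Proof. by apply: (addrI (c 0 i)); rewrite -cD !addr0. Qed.

Lemma coefB x y i : c (x - y) i = c x i - c y i.
Proof.
by apply: (addIr (c y i)); rewrite -cD !subrK.
Qed.

Lemma coefMn x n i : c (x *+ n) i = c x i *+ n.
Proof. by elim: n => [|n IHn]; rewrite ?mulr0n ?coef0// !mulrS cD IHn. Qed.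

End Coefficients.

(** In characteristic 0 the natural numbers would embed in k. *)
Lemma finite_field_pchar (k : fieldType) :
  finite_set [set: k] -> exists p, p \in [pchar k].
Proof.
move=> fk; have [n n_gt0 n0] : exists2 n, (0 < n)%N & n%:R == 0 :> k.
  apply: contrapT => non; apply: infinite_nat.
  rewrite -[setT](@preimage_setT _ k (fun n => n%:R)).
  apply: finite_preimage fk => m n _ _ mn; apply: contrapT => /eqP.
  wlog mn_lt : m n mn / (m < n)%N.
    by move=> W; rewrite neq_ltn => /orP[] lt; [apply: (W m n)|apply: (W n m)];
      rewrite ?neq_ltn ?lt ?orbT.
  move=> _; apply: non; exists (n - m)%N; first by rewrite subn_gt0.
  by rewrite natrB 1?ltnW// mn subrr.
by have [p] := natf0_pchar n_gt0 n0; exists p.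
Qed.

Lemma laurent_inj (F k : fieldType) (c : F -> int -> k) :
  laurent_iso c -> injective c.
Proof. by move=> [[_ ci _] _ _] x y; apply: ci; rewrite inE. Qed.

Lemma laurent_pchar (F k : fieldType) (c : F -> int -> k) p :
  laurent_iso c -> p \in [pchar k] -> p \in [pchar F].
Proof.
move=> cL /andP[p_pr /eqP p0]; apply/andP; split=> //; apply/eqP.
apply: (laurent_inj cL); apply: funext => i.
by rewrite (coefMn (laurentD cL)) (coef0 (laurentD cL)) -mulr_natl p0 mul0r.
Qed.

Lemma mixed_inj (L F : fieldType) vL v (c : F -> int -> L) :
  mixed_iso vL v c -> injective c.
Proof. by move=> [[_ ci _] _ _ _] x y; apply: ci; rewrite inE. Qed.

(** The element with the single coefficient 1 at index 0 is not killed by p,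
    because its coefficient is not. *)
Lemma mixed_pchar0 (L F : fieldType) vL v (c : F -> int -> L) :
  complete_discrete_valuation vL -> mixed_iso vL v c ->
  [pchar L] =i pred0 -> [pchar F] =i pred0.
Proof.
move=> cvL cM L0 p; rewrite [RHS]inE; apply/negP => /andP[p_pr /eqP p0].
have [x _ cx] : exists2 x, [set: F] x & c x = update (fun=> 0) 0 1.
  have [_ _ csurj] := mixed_bij cM; apply: csurj; split.
    exists 0 => i; rewrite /update; case: eqP => _.
      by rewrite (valuation1 cvL).
    by rewrite (valuation0 cvL) leey.
  by move=> N; exists 0 => i i0; rewrite update_other ?lt_eqF// (valuation0 cvL) leey.
have : p \in [pchar L].
  apply/andP; split=> //; apply/eqP.
  rewrite -[1](update_same (fun=> 0 : L) 0) -cx -(coefMn (mixedD cM)).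
  by rewrite -mulr_natl p0 mul0r (coef0 (mixedD cM)).
by rewrite L0.
Qed.

Lemma canonical_lifting_pchar0 m (F k : fieldType) v (rho : F -> k) pi h :
  canonical_lifting m v rho pi h -> [pchar F] =i pred0.
Proof.
elim: m => [|m IHm] in F k v rho pi h *; first by move=> [_ [_ []]].
move=> [_ [_ [L [l [vL [rhoL [piL [hL [c [cb [lL [cM _ _ _ _]]]]]]]]]]]].
apply: mixed_pchar0 cM (IHm _ _ _ _ _ _ lL).
by case: m lL {IHm} => [|m] [].
Qed.

Lemma canonical_lifting_residue_pchar m (F k : fieldType) v (rho : F -> k) pi h :
  canonical_lifting m v rho pi h -> exists p, p \in [pchar k].
Proof.
elim: m => [|m IHm] in F k v rho pi h *.
  by move=> [_ [_ [_ fk _ _ _]]]; exact: finite_field_pchar.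
move=> [_ [_ [L [l [vL [rhoL [piL [hL [c [cb [lL [_ cbL _ _ _]]]]]]]]]]]].
by have [p lp] := IHm _ _ _ _ _ _ lL; exists p; exact: laurent_pchar cbL lp.
Qed.

(** What the canonical lifting is used for: all the arithmetic of the tower
    K{{t_1}}...{{t_m}} enters through these properties and the characteristics. *)
Lemma canonical_liftingP m (F k : fieldType) v (rho : F -> k) pi h :
  canonical_lifting m v rho pi h ->
  [/\ complete_discrete_valuation v, residue_map v rho, v pi = 1%:E, h 0 = 0 &
      forall a, (0 <= v (h a))%E /\ rho (h a) = a].
Proof.
elim: m => [|m IHm] in F k v rho pi h *.
  move=> [cv [rv [_ _ vpi hS hM]]]; split=> //.
  (* h 0 is an idempotent with residue 0. *)
  have /eqP := hM 0 0; rewrite mulr0 -subr_eq0 -{1}[h 0]mulr1 -mulrBr mulf_eq0.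
  case/orP => [/eqP //|]; rewrite subr_eq0 => /eqP h01.
  have := proj2 (hS 0); rewrite -h01 (residue1 rv) => /eqP.
  by rewrite oner_eq0.
move=> [cv [rv [L [l [vL [rhoL [piL [hL [c [cb [lL [cM cbL crho cpi ch]]]]]]]]]]]].
have [cvL rvL vpiL hL0 hLS] := IHm _ _ _ _ _ _ lL; split=> //.
- have vle z : (z <= v pi)%E <-> (z <= 1%:E)%E.
    rewrite (mixed_val cM); split=> [/(_ 0)|z1 i]; rewrite cpi ?eqxx ?vpiL//.
    by case: eqP => _; rewrite ?vpiL// (valuation0 cvL) leey.
  by apply/eqP; rewrite eq_le; apply/andP; split; apply/vle.
- apply: (mixed_inj cM); apply: funext => i.
  by rewrite ch (coef0 (laurentD cbL)) hL0 (coef0 (mixedD cM)).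
- move=> a; have va : (0 <= v (h a))%E.
    by apply/(mixed_val cM) => i; rewrite ch; case: (hLS (cb a i)).
  split=> //; apply: (laurent_inj cbL); apply: funext => i.
  by rewrite crho// ch; case: (hLS (cb a i)).
Qed.

(** * Equal characteristic *)

Section LaurentExpansions.
Context (F k : topFieldType) (c : F -> int -> k) (cL : laurent_iso c).

(** Here the terms a t^i are additive in a; this is what fails for liftings. *)
Lemma laurent_expansion_system : exists e : int -> k -> F,
  expansion_system (fun f x => c x = f) e /\
  forall i a b, e i (a - b) = e i a - e i b.
Proof.
have cD := laurentD cL; have cI := laurent_inj cL.
have /choice[e eP] (ia : int * k) : exists x, c x = update (fun=> 0) ia.1 ia.2.
  have [_ _ csurj] := laurent_bij cL.
  have [|x _ <-] := csurj (update (fun=> 0) ia.1 ia.2); last by exists x.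
  by exists ia.1 => i ilt; rewrite update_other// lt_eqF.
exists (fun i a => e (i, a)); split; last first.
  move=> i a b; apply/cI/funext => j.
  by rewrite (coefB cD) !eP /update/=; case: eqP; rewrite ?subr0.
split.
- by apply/funext => i; rewrite (coef0 cD).
- move=> i; apply/cI/funext => j.
  by rewrite eP (coef0 cD) /update/=; case: eqP.
- move=> f x i a xf; apply/funext => j.
  rewrite cD (coefB cD) !eP xf /update/=; case: eqP => [->|_].
    by rewrite subrr add0r.
  by rewrite subr0 addr0.
Qed.

Lemma laurent_baseE : laurent_base c = expansion_base (fun f x => c x = f).
Proof.
apply/seteqP; split=> V [U sU ->]; exists U => //; apply/seteqP; split=> x /=.
- move=> Ux; exists (c x); split=> //.
  by have [cf _ _] := laurent_bij cL; exact: (cf x I).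
- by move=> [f [_ Uf ->]].
- by move=> [f [_ Uf ->]].
- move=> Ux; exists (c x); split=> //.
  by have [cf _ _] := laurent_bij cL; exact: (cf x I).
Qed.

Hypothesis baseF : open_base_at0 (laurent_base c).

(** Since a t^i is additive in a and continuous at 0, the set of the a such that
    a t^i is in H inherits both properties of H. *)
Lemma laurent_nbhs0 (H : set F) :
  (forall G : set k, add_subgroup G -> absorbs_null_sequences G -> nbhs 0 G) ->
  add_subgroup H -> absorbs_null_sequences H -> nbhs 0 H.
Proof.
move=> IHk sH aH.
have [e [Ee eB]] := laurent_expansion_system.
have baseE := baseF; rewrite laurent_baseE in baseE.
have [N tailH] := absorbed_tail baseE aH.
apply: (nbhs_of_term_nbhs Ee baseE sH tailH) => i _; apply: IHk.
  split=> [|a b Ha Hb] /=; last by rewrite eB; exact: add_subgroupB.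
  by rewrite (expansion_term0 Ee); exact: add_subgroup0.
move=> u u0; apply: aH.
exact: cvg_comp u0 (cvg_expansion_term Ee baseE i).
Qed.

(** The elements whose coefficients lie in given subgroups W_i form a subgroup.
    To get a neighbourhood of 0, W_i must be the whole field for large i, hence
    the case distinction on i0. *)
Lemma laurent_subgroup_base :
  (forall V : set k, nbhs 0 V ->
     exists W, [/\ add_subgroup W, nbhs 0 W & W `<=` V]) ->
  forall V : set F, nbhs 0 V ->
     exists W, [/\ add_subgroup W, nbhs 0 W & W `<=` V].
Proof.
move=> IHk V0 /(proj2 baseF)[V1 [U [oU [i0 Ui0]] ->] UV].
have /choice[W WP] i :
    exists W, [/\ add_subgroup W, nbhs 0 W, W `<=` U i & (i0 <= i -> W = setT)].
  have [/Ui0 ->|_] := leP i0 i; first by exists setT; split=> //; exact: filterT.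
  by have [W [sW nW WU]] := IHk _ (open_nbhs_nbhs (oU i)); exists W; split.
exists [set x | forall i, W i (c x i)]; split.
- have cD := laurentD cL; split=> [i|x y Wx Wy i]; have [sW _ _ _] := WP i.
    by rewrite (coef0 cD); exact: add_subgroup0.
  by rewrite (coefB cD); apply: add_subgroupB.
- have sW : nbhs0_sequence (fun i => (W i)°).
    split=> [i|]; first by have [_ nW _ _] := WP i; split=> //; exact: open_interior.
    by exists i0 => i ii0; have [_ _ _ ->//] := WP i; exact: interiorT.
  have : nbhs 0 [set x | forall i, (W i)° (c x i)].
    by apply/open_nbhs_nbhs/(proj1 baseF); exists (fun i => (W i)°).
  by apply: filterS => x Wx i; apply: interior_subset (Wx i).
- by move=> x Wx; apply: UV => i; have [_ _ + _] := WP i; apply.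
Qed.

End LaurentExpansions.

(** * The standard mixed case *)

Section LiftedExpansions.
Context (F k : topFieldType) (v : F -> \bar int) (rho : F -> k) (pi : F).
Context (h : k -> F).
Hypotheses (cv : complete_discrete_valuation v) (rv : residue_map v rho).
Hypotheses (vpi : v pi = 1%:E) (h0 : h 0 = 0).
Hypothesis hS : forall a, (0 <= v (h a))%E /\ rho (h a) = a.

Definition lifted_sum (f : int -> k) (x : F) : Prop :=
  val_sum v (fun i => h (f i) * pi ^ i) x.

Definition lifted_term (i : int) (a : k) : F := h a * pi ^ i.

Lemma lifted_expansion_system : expansion_system lifted_sum lifted_term.
Proof.
split.
- rewrite /lifted_sum (_ : (fun _ => _) = fun=> 0); first exact: val_sum0.
  by apply/funext => i; rewrite h0 mul0r.
- by move=> i; rewrite /lifted_term h0 mul0r.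
- move=> f x i a /(val_sum_update i (h a * pi ^ i)).
  rewrite /lifted_sum; congr (val_sum v _ _); apply/funext => j.
  by rewrite /update; case: eqP => // ->.
Qed.

(** Without its leading term the sum has valuation at least i + 1, so y and
    h (f i) have the same residue. *)
Lemma lifted_digit f (i : int) y : (0 <= v y)%E ->
  (forall j, j < i -> f j = 0) -> lifted_sum f (y * pi ^ i) -> f i = rho y.
Proof.
move=> vy f0 /(expansion_cut lifted_expansion_system i).
have [vhf rhf] := hS (f i).
have vpiE j : v (pi ^ j) = j%:E by exact: valuation_exprz.
rewrite /= /lifted_term -mulrBl => fy.
have : ((i + 1)%:E <= v ((y - h (f i)) * pi ^ i)%R)%E.
  apply: (val_sum_ge cv) fy => j; rewrite (valuationM cv) vpiE /update.
  case: eqP => [_|/eqP ji]; first by rewrite h0 (valuation0 cv) addye// leey.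
  have [ji'|ij] := ltP j i; first by rewrite f0// h0 (valuation0 cv) addye// leey.
  have [vhj _] := hS (f j); apply: (@le_trans _ _ (0 + j%:E)%E).
    by rewrite add0e lee_fin; lia.
  exact: leeD.
rewrite (valuationM cv) vpiE => vle.
suff v_gt0 : (0 < v (y - h (f i))%R)%E.
  apply/esym/eqP; rewrite -subr_eq0 -rhf -(residueB cv rv)//.
  by apply/eqP/(residue_ker rv) => //; exact: ltW.
move: vle; case: (v (y - h (f i))) => [z||] //.
by rewrite -EFinD lee_fin lte_fin; lia.
Qed.

(** The leading index of an expansion is not below the valuation of its sum: for
    j < i write y pi^i = (y pi^(i - j)) pi^j, whose digit at j is 0 because
    y pi^(i - j) has residue 0. *)
Lemma lifted_digits f (m i : int) y : (0 <= v y)%E ->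
  (forall j, j < m -> f j = 0) -> lifted_sum f (y * pi ^ i) ->
  (forall j, j < i -> f j = 0) /\ f i = rho y.
Proof.
move=> vy fm fy.
suff f0 j : j < i -> f j = 0 by split=> //; apply: lifted_digit.
have [d] : exists d : nat, j - m < d%:Z by exists (absz (j - m)).+1; lia.
have pi0 : pi != 0 by apply/eqP => pi0; move: vpi; rewrite pi0 (valuation0 cv).
elim: d j => [|d IHd] j jd ji; first by apply: fm; lia.
have f0 j' : j' < j -> f j' = 0 by move=> ?; apply: IHd; lia.
have yE : y * pi ^ i = y * pi ^ (i - j) * pi ^ j.
  by rewrite -mulrA -expfzDr// subrK.
have vy' : (0 < v (y * pi ^ (i - j))%R)%E.
  rewrite (valuationM cv) valuation_exprz//.
  apply: (@lt_le_trans _ _ (0 + (i - j)%:E)%E); last exact: leeD.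
  by rewrite add0e lte_fin; lia.
rewrite yE in fy; rewrite (lifted_digit (ltW vy') f0 fy).
by apply/(residue_ker rv) => //; exact: ltW.
Qed.

Hypothesis gF : additive_group_topology F.
Hypothesis baseF : open_base_at0 (lifting_base v pi h).
Hypothesis subgroup_base : forall V : set k, nbhs 0 V ->
  exists W, [/\ add_subgroup W, nbhs 0 W & W `<=` V].

(** Descending induction on the index i of the terms, starting from the indices
    beyond which H absorbs everything. At index i, the carries of the addition
    of two terms only involve larger indices, so that near 0 they belong to H
    and the set of the a such that h(a) pi^i is in H is a subgroup of an open
    subgroup of the residue field. *)
Lemma lifted_nbhs0 (H : set F) :
  (forall G : set k, add_subgroup G -> absorbs_null_sequences G -> nbhs 0 G) ->
  add_subgroup H -> absorbs_null_sequences H -> nbhs 0 H.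
Proof.
move=> IHk sH aH.
have Ee := lifted_expansion_system.
have baseE : open_base_at0 (expansion_base lifted_sum) := baseF.
have [N tailH] := absorbed_tail baseE aH.
apply: (nbhs_of_term_nbhs Ee baseE sH tailH) => i _.
have [d] : exists d : nat, N - i <= d%:Z by exists (absz (N - i)); lia.
elim: d i => [|d IHd] i id.
  apply: filterS filterT => a _; apply: tailH (expansion_term Ee i a).
  by move=> j jN; rewrite update_other//; lia.
(* The coefficients of index at most i are left free: for carries they are
   determined by [lifted_digits]. *)
pose U j := if (i < j) && (j < N) then [set a | H (lifted_term j a)]° else setT.
have sU : nbhs0_sequence U.
  split=> [j|]; last by exists N => j Nj; rewrite /U [j < N]ltNge Nj andbF.
  rewrite /U; case: ifPn => [/andP[ij jN]|_]; last by split; [exact: openT|].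
  by split; [exact: open_interior|apply: IHd; lia].
have nV : nbhs (0 + 0 : F) [set x | exists f : int -> k,
      [/\ exists m : int, forall i : int, i < m -> f i = 0,
          forall i, U i (f i) & lifted_sum f x]].
  by rewrite addr0; exact: (nbhs_expansion_base baseE sU).
have [[P Q] /= [nP nQ] PQ] := gF.1 (0, 0) _ nV.
have [W [sW nW WPQ]] := subgroup_base (filterI
  (cvg_expansion_term Ee baseE i nP) (cvg_expansion_term Ee baseE i nQ)).
have carry a b : W a -> W b ->
    H (lifted_term i a + lifted_term i b - lifted_term i (a + b)).
  move=> /WPQ[/= Pa _] /WPQ[/= _ Qb].
  have [f [[m fm] fU fab]] :=
    PQ (lifted_term i a, lifted_term i b) (conj Pa Qb).
  have [va ra] := hS a; have [vb rb] := hS b.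
  have fab' : lifted_sum f ((h a + h b) * pi ^ i) by rewrite mulrDl.
  have [f0 fi] := lifted_digits (valuation_geD cv va vb) fm fab'.
  rewrite (residueD rv)// ra rb in fi.
  have := expansion_cut Ee i fab; rewrite /= fi.
  apply: (@expansion_mem _ _ _ _ Ee _ sH N (i + 1) _ _ tailH).
    move=> j ji; rewrite /update; case: eqP => // /eqP ji'; apply: f0; lia.
  move=> j /andP[ij jN]; rewrite update_other; last by lia.
  have := fU j; rewrite /U ifT; first exact: interior_subset.
  by apply/andP; split=> //; lia.
suff : nbhs 0 (W `&` [set a | H (lifted_term i a)]).
  by apply: filterS => a [].
apply: IHk.
  split=> [|a b [Wa Ha] [Wb Hb]] /=.
    by split; [|rewrite (expansion_term0 Ee)]; apply: add_subgroup0.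
  have Wab : W (a - b) by apply: add_subgroupB.
  split=> //.
  (* Applied to a - b and b, the carry property gives closure under subtraction
     at once. *)
  have := carry _ _ Wab Wb; rewrite subrK => Hab.
  have := add_subgroupB sH (add_subgroupD sH Hab Ha) Hb.
  by rewrite subrK addrK.
move=> u u0; apply: filterI; first exact: u0.
by apply: aH; exact: cvg_comp u0 (cvg_expansion_term Ee baseE i).
Qed.

End LiftedExpansions.

(** * Finite extensions of standard fields *)

Section FiniteExtension.
Context (F M : topFieldType) (d : nat) (phi : F -> 'rV[M]_d).
Context (psi : 'rV[M]_d -> F).
Hypotheses (phiK : cancel phi psi) (psiK : cancel psi phi).
Hypothesis phiD : forall x y, phi (x + y) = phi x + phi y.
Hypothesis phi_open : forall A : set F, open A <-> open (phi @` A).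

Let phi0 : phi 0 = 0.
Proof. by apply: (addrI (phi 0)); rewrite -phiD !addr0. Qed.

Let psiD A B : psi (A + B) = psi A + psi B.
Proof. by apply: (can_inj phiK); rewrite phiD !psiK. Qed.

Let psi0 : psi 0 = 0.
Proof. by rewrite -phi0 phiK. Qed.

Let psiB A B : psi (A - B) = psi A - psi B.
Proof. by apply/eqP; rewrite eq_sym subr_eq -psiD subrK. Qed.

(** [phi] is a homeomorphism onto M^d, whose neighbourhoods contain boxes. *)
Lemma coordinates_nbhs (x : F) (A : set F) :
  nbhs x A <-> exists2 P : 'I_d -> set M,
    (forall j, nbhs (phi x 0 j) (P j)) &
    (forall B : 'rV[M]_d, (forall j, P j (B 0 j)) -> A (psi B)).
Proof.
split.
  rewrite nbhsE => -[B [oB Bx] BA].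
  have : nbhs (phi x) (phi @` B).
    by apply: open_nbhs_nbhs; split; [apply/phi_open|exists x].
  move=> [P nP PB]; exists (P 0); first by move=> j; exact: nP.
  move=> C PC; have [|y By <-] := PB C; first by move=> i j; rewrite ord1.
  by rewrite phiK; exact: BA.
move=> [P nP PA]; have : nbhs (phi x) (psi @^-1` A).
  by exists (fun _ j => P j) => [i j|B PB]; [rewrite ord1|exact: PA].
rewrite nbhsE => -[B [oB Bx] BA]; rewrite nbhsE.
exists (phi @^-1` B); last by move=> y /BA; rewrite /= phiK.
split=> //; apply/phi_open; suff -> : phi @` (phi @^-1` B) = B by [].
by apply/image_preimage/seteqP; split=> // C _; exists (psi C).
Qed.

Lemma coordinates_translation : (forall a : M, continuous (+%R a)) ->
  forall a : F, continuous (+%R a).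
Proof.
move=> cM a x A /coordinates_nbhs[P nP PA]; apply/coordinates_nbhs.
exists (fun j => [set m | P j (phi a 0 j + m)]) => [j|B PB].
  by apply: cM; have := nP j; rewrite phiD mxE.
rewrite /= -[a]phiK -psiD; apply: PA => j.
by rewrite mxE; exact: PB.
Qed.

(** H contains the sum of its traces on the coordinate axes, and these are
    subgroups of M absorbing null sequences. *)
Lemma coordinates_nbhs0 (H : set F) :
  (forall G : set M, add_subgroup G -> absorbs_null_sequences G -> nbhs 0 G) ->
  add_subgroup H -> absorbs_null_sequences H -> nbhs 0 H.
Proof.
move=> IHM sH aH; apply/coordinates_nbhs; rewrite phi0.
exists (fun j => [set m | H (psi (m *: delta_mx 0 j))]) => [j|B HB]; last first.
  rewrite (row_sum_delta B).
  apply: (big_ind (fun B => H (psi B))) => [||j _]; last exact: HB.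
    by rewrite psi0; exact: add_subgroup0.
  by move=> C D HC HD; rewrite psiD; exact: add_subgroupD.
rewrite mxE; apply: IHM => [|u u0].
  split=> [|a b Ha Hb] /=; first by rewrite scale0r psi0; exact: add_subgroup0.
  by rewrite scalerBl psiB; exact: add_subgroupB.
apply: (aH (fun n => psi (u n *: delta_mx 0 j))) => W /coordinates_nbhs[P nP PW].
have uP : \forall n \near \oo, P j (u n).
  by apply: u0; have := nP j; rewrite phi0 mxE.
suff : \forall n \near \oo, W (psi (u n *: delta_mx 0 j)) by [].
apply: filterS uP => n Pun; apply: PW => j'.
rewrite !mxE eqxx /=; case: eqP => [->|_]; first by rewrite mulr1.
by rewrite mulr0; have := nbhs_singleton (nP j'); rewrite phi0 mxE.
Qed.

End FiniteExtension.

(** * Higher topologies *)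

Lemma group_topology_translation (F : topFieldType) :
  additive_group_topology F -> forall a : F, continuous (+%R a).
Proof.
move=> [addF _] a x A /(addF (a, x))[[P Q] /= [nP nQ] PQ].
apply: filterS nQ => y Qy; apply: (PQ (a, y)).
by split=> //; exact: nbhs_singleton nP.
Qed.

Lemma higher_topology_translation n (F : topFieldType) :
  higher_topology n F -> forall a : F, continuous (+%R a).
Proof.
elim=> {n F}.
- move=> F _ oF a x A /nbhs_singleton Aax.
  by apply: open_nbhs_nbhs; split; [exact: oF|].
- by move=> n F k v rho c _ _ _ _ _ _ gF _; exact: group_topology_translation.
- by move=> n F k v rho pi h _ _ _ gF _; exact: group_topology_translation.
- move=> n F k v rho M iota d phi _ _ _ _ _ _ _ IHM [psi phiK psiK] phiD _ oP.
  exact: coordinates_translation phiK psiK phiD oP IHM.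
Qed.

(** Positive characteristic leaves only iterated Laurent series over a finite
    field: the two mixed constructions produce fields of characteristic 0, as p
    vanishing in F also vanishes in the residue field. *)
Lemma higher_topology_subgroup_base n (F : topFieldType) p :
  higher_topology n F -> p \in [pchar F] ->
  forall V : set F, nbhs 0 V ->
    exists W, [/\ add_subgroup W, nbhs 0 W & W `<=` V].
Proof.
elim=> {n F}.
- move=> F _ oF _ V nV; exists [set 0]; split.
  + by split=> // x y -> ->; rewrite /= subr0.
  + by apply: open_nbhs_nbhs; split; [exact: oF|].
  + by move=> x ->; exact: nbhs_singleton nV.
- move=> n F k v rho c _ _ _ IHk Fk cL _ baseF pF.
  by apply: (laurent_subgroup_base cL baseF); apply: IHk; rewrite -Fk.
- move=> n F k v rho pi h lh _ _ _ _ pF.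
  by have := canonical_lifting_pchar0 lh p; rewrite pF.
- move=> n F k v rho M iota d phi cv rv _ Fk _ _ _ _ _ _ _ _ pF.
  case: Fk => q; have pk := residue_pchar cv rv pF.
  by rewrite (pcharf_eq pF) (pcharf_eq pk).
Qed.

(** Both hypothesis and conclusion concern only the point 0, so that the
    induction never has to translate in the residue field. *)
Lemma higher_topology_nbhs0 n (F : topFieldType) (H : set F) :
  higher_topology n F -> add_subgroup H -> absorbs_null_sequences H ->
  nbhs 0 H.
Proof.
move=> hF; elim: hF H => {n F}.
- move=> F _ oF H sH _.
  by apply: open_nbhs_nbhs; split; [exact: oF|exact: add_subgroup0].
- move=> n F k v rho c _ _ _ IHk _ cL _ baseF H.
  exact: laurent_nbhs0 cL baseF H IHk.
- move=> n F k v rho pi h lh hk IHk gF baseF H.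
  have [cv rv vpi h0 hS] := canonical_liftingP lh.
  have [p pk] := canonical_lifting_residue_pchar lh.
  apply: (lifted_nbhs0 cv rv vpi h0 hS gF baseF) => //.
  exact: higher_topology_subgroup_base hk pk.
- move=> n F k v rho M iota d phi _ _ _ _ _ _ _ IHM [psi phiK psiK] phiD _ oP H.
  exact: coordinates_nbhs0 phiK psiK phiD oP H IHM.
Qed.

Lemma open_subgroup (F : topFieldType) (H : set F) :
  (forall a : F, continuous (+%R a)) -> add_subgroup H -> nbhs 0 H -> open H.
Proof.
move=> cF sH nH; rewrite openE => x Hx.
have nx : \forall y \near x, H (- x + y) by apply: cF; rewrite addNr.
apply: filterS nx => y Hy.
by rewrite -[y](addKr (- x)) opprK; exact: add_subgroupD.
Qed.

Lemma open_seq_saturationE (T : topologicalType) (A : set T) :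
  @open (seq_saturation T) A = seq_open A.
Proof. by []. Qed.

Theorem theorem3p8 (n : nat) (F : topFieldType) (n_ge1 : (1 <= n)%N)
    (F_local : local_field n F) (F_higher : higher_topology n F)
    (H : set F) (H_subgroup : GRing.zmod_closed [in H]) :
  open H <-> @open (seq_saturation F) H.
Proof.
have sH : add_subgroup H.
  have [H0 HB] := H_subgroup.
  split=> [|x y Hx Hy]; first by move: H0; rewrite inE.
  by have := HB x y; rewrite !inE; apply.
rewrite open_seq_saturationE; split=> [oH u x Hx ux|seqH].
  by apply: ux; apply: open_nbhs_nbhs.
apply: (open_subgroup (higher_topology_translation F_higher) sH).
apply: (higher_topology_nbhs0 F_higher sH) => u u0.
exact: seqH (add_subgroup0 sH) u0.
Qed.
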